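(* Let $d,t,m\ge 1$ be integers and let $\{h_1,\dots,h_t\}\subset\mathbb{Z}^d$ be such that $h_1\mathbb{Z}+h_2\mathbb{Z}+\cdots+h_t\mathbb{Z}=\mathbb{Z}^d$. Let $f\in C(\mathbb{Z}^d,\mathbb{C})$. If $\Delta_{h_k}^m f=0$ for $k=1,\dots,t$, then there exist $N\in\mathbb{N}$ and complex numbers $a_\alpha$ (for $\alpha\in\mathbb{N}^d$, $|\alpha|<N$) such that $f(n)=\sum_{|\alpha|<N}a_\alpha n^\alpha$ for all $n\in\mathbb{Z}^d$; that is, $f$ is an ordinary polynomial on $\mathbb{Z}^d$. Furthermore, if $d=1$, then there exist complex numbers $a_0,\dots,a_{m-1}$ such that $f(n)=a_0+a_1n+\cdots+a_{m-1}n^{m-1}$ for all $n\in\mathbb{Z}$, i.e. $f$ is an ordinary polynomial on $\mathbb{Z}$ of degree $\le m-1$.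
   Context: $C(\mathbb{Z}^d,\mathbb{C})$ is the space of all functions $\mathbb{Z}^d\to\mathbb{C}$ ($\mathbb{Z}^d$ is discrete). For $h\in\mathbb{Z}^d$, $(\Delta_h f)(n)=f(n+h)-f(n)$, and $\Delta_h^m$ is the $m$-th iterate of the operator $\Delta_h$, that is, $\Delta_h^m f(n)=\sum_{k=0}^m\binom{m}{k}(-1)^{m-k}f(n+kh)$. The set $h_1\mathbb{Z}+\cdots+h_t\mathbb{Z}$ is the additive subgroup generated by $h_1,\dots,h_t$. Here $\mathbb{N}$ includes $0$; for $\alpha\in\mathbb{N}^d$ and $n\in\mathbb{Z}^d$, $n^\alpha=n_1^{\alpha_1}\cdots n_d^{\alpha_d}$ (with $0^0=1$) and $|\alpha|=\alpha_1+\cdots+\alpha_d$. *)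

(* Defs.v *)
From mathcomp Require Export all_boot all_order all_algebra.
From mathcomp Require Export reals complex mpoly.

(* The complex numbers are R[i] for a
   realType R, and Z^d is 'rV[int]_d. *)

Set Implicit Arguments.
Unset Strict Implicit.
Unset Printing Implicit Defensive.

Import GRing.Theory.
Local Open Scope ring_scope.

Definition fdiff (V W : zmodType) (h : V) (f : V -> W) : V -> W :=
  fun n => f (n + h) - f n.

(* The power n^alpha of an integer vector, read in R. Since x ^+ 0 = 1 also for
   x = 0, the convention 0^0 = 1 is respected. *)
Definition expmon (R : nzRingType) (d : nat) (n : 'rV[int]_d)
    (alpha : 'X_{1..d}) : R :=
  \prod_(i < d) (n 0 i)%:~R ^+ alpha i.

(* Main.v *)
Require Import Defs.
From mathcomp Require Import ring.

Set Implicit Arguments.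
Unset Strict Implicit.
Unset Printing Implicit Defensive.

Import GRing.Theory Num.Theory.

Local Open Scope ring_scope.

(** The idea is that [iter m (fdiff h) f = 0] lets one write, for every integer
    [k], the Newton expansion
      f (x + k h) = \sum_(j < m) binom(k, j) (Delta_h^j f)(x),
    which is a polynomial in [k] (lemma [newton_expansion]).  Since difference
    operators commute, each [Delta_h^j f] is again annihilated by the operators
    [Delta_{h_k}^m], so the expansion can be repeated in the other directions:
    [f (x + \sum_k l_k h_k)] is a polynomial in the integers [l_k] (lemma
    [polyfun_lattice]).  As the [h_k] generate Z^d, writing the vectors of the
    standard basis as integral combinations of them gives additive functions
    [l_k] on Z^d with [n = \sum_k l_k(n) h_k]; these are linear in the
    coordinates of [n], whence the first claim.  The [h_k] may satisfy
    relations: only one choice of the [l_k] is used, so this is harmless.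

    When d = 1, the first claim gives [f(z) = P(z)] for a polynomial [P] whose
    degree is not controlled.  Some [h_k] is a nonzero integer [s], and the
    Newton expansion along it says that [P(k s)] agrees for all integers [k]
    with a polynomial of size at most [m] in [k].  A polynomial is determined
    by its values on [s Z], so [P] itself has size at most [m]
    (lemma [size_poly_eq_on_multiples]). *)

(** * Newton polynomials *)

(** The binomial coefficient binom(X, j). *)
Definition newton_poly (F : fieldType) (j : nat) : {poly F} :=
  (j`!%:R)^-1 *: \prod_(i < j) ('X - i%:R%:P).

Section NewtonPoly.
Variable F : numFieldType.

Lemma newton_poly0 : newton_poly F 0 = 1.
Proof. by rewrite /newton_poly big_ord0 fact0 invr1 scale1r. Qed.

Lemma newton_polyS_at0 j : (newton_poly F j.+1).[0] = 0.
Proof. by rewrite hornerZ big_ord_recl hornerM hornerXsubC subrr mul0r mulr0. Qed.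

Lemma size_newton_poly j : size (newton_poly F j) = j.+1.
Proof.
rewrite size_scale ?invr_eq0 ?pnatr_eq0 -?lt0n ?fact_gt0 //.
by rewrite size_prod_XsubC [index_enum _]unlock -enumT size_enum_ord.
Qed.

(** Pascal's rule; both products share the factor x (x - 1) ... (x - j + 1),
    and the two remaining factors x + 1 and x - j differ by j + 1. *)
Lemma newton_polyS_diff j (x : F) :
  (newton_poly F j.+1).[x + 1] - (newton_poly F j.+1).[x]
    = (newton_poly F j).[x].
Proof.
rewrite !hornerZ [in X in X - _]big_ord_recl [in X in _ - X]big_ord_recr /=.
have -> : \prod_(i < j) ('X - (lift ord0 i)%:R%:P) =
          \prod_(i < j) ('X - i.+1%:R%:P) :> {poly F}.
  by apply: eq_bigr.
rewrite !hornerM !horner_prod !hornerXsubC.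
have -> : \prod_(i < j) ('X - i.+1%:R%:P).[x + 1] =
          \prod_(i < j) ('X - i%:R%:P).[x] :> F.
  by apply: eq_bigr => i _; rewrite !hornerE -natr1; ring.
have j1 : j.+1%:R != 0 :> F by rewrite pnatr_eq0.
have jf : j`!%:R != 0 :> F by rewrite pnatr_eq0 -lt0n fact_gt0.
rewrite factS natrM -natr1 in j1 * => /=.
by field; rewrite j1 jf.
Qed.

End NewtonPoly.

(** * Iterated differences *)

Section Differences.
Variables (V W : zmodType).
Implicit Types (h x : V) (f : V -> W).

Lemma iter_fdiffC m h h' f x :
  iter m (fdiff h') (fdiff h f) x = fdiff h (iter m (fdiff h') f) x.
Proof.
elim: m x => //= m IH x; rewrite /fdiff !IH /fdiff.
rewrite (addrAC x h h') !opprB !addrA [LHS]addrAC [RHS]addrAC.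
by congr (_ + _); exact: addrAC.
Qed.

(** Commutation of differences; this is what allows expanding in several
    directions in turn. *)
Lemma iter_fdiff_eq0 m j h h' f :
  (forall x, iter m (fdiff h') f x = 0) ->
  forall x, iter m (fdiff h') (iter j (fdiff h) f) x = 0.
Proof.
move=> f0; elim: j => //= j IH x.
by rewrite iter_fdiffC /fdiff !IH subrr.
Qed.

End Differences.

Lemma int_shift_invariant (T : Type) (g : int -> T) :
  (forall k, g (k + 1) = g k) -> forall k, g k = g 0.
Proof.
move=> g1; elim/int_rect => [//|k IH|k IH].
  by rewrite -addn1 PoszD g1.
by rewrite -IH -[in RHS](subrK 1 (- k%:Z)) g1 -addn1 PoszD opprD.
Qed.

(** Both sides agree at [k = 0]; their increments in [k] agree by the statement
    for [Delta_h f] with one order less, since the increment of binom(k, j + 1)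
    is binom(k, j).  Integers being reached from 0 by unit steps in both
    directions, this proves the expansion for negative [k] too. *)
Lemma newton_expansion (F : numFieldType) (V : zmodType) (m : nat) (h : V)
    (f : V -> F) :
  (forall x, iter m (fdiff h) f x = 0) ->
  forall x (k : int),
    f (x + h *~ k) =
    \sum_(j < m) (newton_poly F j).[k%:~R] * iter j (fdiff h) f x.
Proof.
elim: m f => [|m IH] f f0 x k; first by rewrite big_ord0; apply: f0.
have Df0 y : iter m (fdiff h) (fdiff h f) y = 0 by rewrite -iterSr f0.
pose S (l : int) := \sum_(j < m.+1) (newton_poly F j).[l%:~R] *
  iter j (fdiff h) f x.
have S1 l : S (l + 1) = S l + fdiff h f (x + h *~ l).
  apply/eqP; rewrite [eqbRHS]addrC -subr_eq (IH _ Df0) /S -sumrB big_ord_recl.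
  rewrite newton_poly0 !hornerC subrr add0r; apply/eqP/eq_bigr => j _.
  by rewrite -mulrBl rmorphD newton_polyS_diff iterSr.
have E1 l : f (x + h *~ (l + 1)) - S (l + 1) = f (x + h *~ l) - S l.
  by rewrite S1 mulrzDr mulr1z addrA /fdiff; ring.
have S0 : S 0 = f x.
  rewrite /S big_ord_recl newton_poly0 hornerC mul1r big1 ?addr0 // => j _.
  by rewrite newton_polyS_at0 mul0r.
have := int_shift_invariant E1 k; rewrite mulr0z addr0 S0 subrr.
by move/eqP; rewrite subr_eq0 => /eqP.
Qed.

(** * Polynomial functions on Z^d *)

Definition polyfun (F : comNzRingType) (d : nat) (g : 'rV[int]_d -> F) :=
  exists p : {mpoly F[d]}, forall n, g n = p.@[fun i => (n 0 i)%:~R].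

Section PolyFun.
Variables (F : comNzRingType) (d : nat).
Implicit Types (g : 'rV[int]_d -> F).

Lemma polyfun_ext g1 g2 : g1 =1 g2 -> polyfun g1 -> polyfun g2.
Proof. by move=> g12 [p gp]; exists p => n; rewrite -g12 gp. Qed.

Lemma polyfun_cst c : polyfun (fun _ : 'rV[int]_d => c : F).
Proof. by exists c%:MP => n; rewrite mevalC. Qed.

Lemma polyfun_coord i : polyfun (fun n : 'rV[int]_d => (n 0 i)%:~R : F).
Proof. by exists 'X_i => n; rewrite mevalXU. Qed.

Lemma polyfunM g1 g2 :
  polyfun g1 -> polyfun g2 -> polyfun (fun n => g1 n * g2 n).
Proof. by move=> [p gp] [q gq]; exists (p * q) => n; rewrite mevalM gp gq. Qed.

Lemma polyfunD g1 g2 :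
  polyfun g1 -> polyfun g2 -> polyfun (fun n => g1 n + g2 n).
Proof. by move=> [p gp] [q gq]; exists (p + q) => n; rewrite mevalD gp gq. Qed.

Lemma polyfun_sum I (r : seq I) (G : I -> 'rV[int]_d -> F) :
  (forall i, polyfun (G i)) -> polyfun (fun n => \sum_(i <- r) G i n).
Proof.
move=> pG; elim: r => [|i r IH].
  by apply: polyfun_ext (polyfun_cst 0) => n; rewrite big_nil.
by apply: polyfun_ext (polyfunD (pG i) IH) => n; rewrite big_cons.
Qed.

Lemma polyfun_horner (p : {poly F}) g :
  polyfun g -> polyfun (fun n => p.[g n]).
Proof.
move=> pg; elim/poly_ind: p => [|p c IH].
  by apply: polyfun_ext (polyfun_cst 0) => n; rewrite horner0.
apply: polyfun_ext (polyfunD (polyfunM IH pg) (polyfun_cst c)) => n.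
by rewrite hornerMXaddC.
Qed.

Lemma polyfun_expmon g : polyfun g ->
  exists (N : nat) (a : 'X_{1..d < N} -> F),
    forall n, g n = \sum_(alpha : 'X_{1..d < N}) a alpha * expmon F n alpha.
Proof.
move=> [p gp]; exists (msize p), (fun alpha => p@_alpha) => n.
rewrite gp [in LHS](mpolywE (leqnn (msize p))) raddf_sum.
by apply: eq_bigr => alpha _ /=; rewrite mevalZ mevalX.
Qed.

End PolyFun.

(** Expanding along [h i] leaves the polynomials [newton_poly F j] at [l i n],
    multiplied by values of [Delta_{h i}^j f] on the points spanned by the
    remaining directions.  The induction therefore has to be over all [f]. *)
Lemma polyfun_lattice (F : numFieldType) (d m : nat) (V : zmodType) (I : Type)
    (r : seq I) (h : I -> V) (l : I -> 'rV[int]_d -> int) (x : V) (f : V -> F) :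
  (forall i, polyfun (fun n => (l i n)%:~R : F)) ->
  (forall i v, iter m (fdiff (h i)) f v = 0) ->
  polyfun (fun n => f (x + \sum_(i <- r) h i *~ l i n)).
Proof.
move=> pl; elim: r f => [|i r IH] f f0.
  by apply: polyfun_ext (polyfun_cst d (f x)) => n; rewrite big_nil addr0.
pose G (j : 'I_m) n := (newton_poly F j).[(l i n)%:~R] *
  iter j (fdiff (h i)) f (x + \sum_(i <- r) h i *~ l i n).
have pG j : polyfun (G j).
  apply: polyfunM; first exact: polyfun_horner.
  by apply: IH => i'; apply: iter_fdiff_eq0.
apply: polyfun_ext (polyfun_sum (index_enum 'I_m) pG) => n.
by rewrite big_cons addrCA addrC (newton_expansion (f0 i)).
Qed.

(** * Polynomials in one variable *)

Lemma poly_eq_on_multiples (F : numFieldType) (p q : {poly F}) (s : F) :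
  s != 0 -> (forall k : nat, p.[s * k%:R] = q.[s * k%:R]) -> p = q.
Proof.
move=> s0 pq; apply/eqP; rewrite -subr_eq0; apply/eqP.
pose rs := [seq s * k%:R | k <- iota 0 (size (p - q))].
apply: (@roots_geq_poly_eq0 _ _ rs); last by rewrite size_map size_iota.
  by apply/allP => _ /mapP[k _ ->]; rewrite rootE hornerD hornerN pq subrr.
rewrite map_inj_uniq ?iota_uniq // => k k' /(mulfI s0) /eqP.
by rewrite eqr_nat => /eqP.
Qed.

(** Rescaling the variable by [s] does not change the size, and turns values
    at multiples of [s] into values at integers. *)
Lemma size_poly_eq_on_multiples (F : numFieldType) (p q : {poly F}) (s : F) :
  s != 0 -> (forall k : nat, p.[s * k%:R] = q.[k%:R]) -> size p = size q.
Proof.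
move=> s0 pq.
have -> : p = q \Po (s^-1 *: 'X).
  apply: (poly_eq_on_multiples s0) => k.
  by rewrite horner_comp hornerZ hornerX mulKf.
by rewrite size_comp_poly2 // size_scale ?invr_eq0 // size_polyX.
Qed.

(** * Generation by integral combinations *)

(** The functions [l k] come from expanding the standard basis, so they are
    linear in the coordinates. *)
Lemma int_span_coord (F : comNzRingType) (d t : nat) (h : t.-tuple 'rV[int]_d) :
  (forall v, inIntSpan h v) ->
  exists l : 'I_t -> 'rV[int]_d -> int,
    (forall k, polyfun (fun n => (l k n)%:~R : F)) /\
    (forall n, n = \sum_(k < t) tnth h k *~ l k n).
Proof.
move=> hspan; have [c cE] := fin_all_exists (fun i => hspan (delta_mx 0 i)).
exists (fun k n => \sum_(i < d) c i k * n 0 i); split=> [k|n].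
  pose G (i : 'I_d) (n : 'rV[int]_d) : F := (c i k)%:~R * (n 0 i)%:~R.
  have pG i : polyfun (G i).
    by apply: polyfunM (polyfun_coord _ _); apply: polyfun_cst.
  apply: polyfun_ext (polyfun_sum (index_enum 'I_d) pG) => n.
  by rewrite rmorph_sum; apply: eq_bigr => i _; rewrite rmorphM.
rewrite [LHS]row_sum_delta.
under [RHS]eq_bigr do rewrite mulrz_sumr.
rewrite exchange_big; apply: eq_bigr => i _ /=.
rewrite -[n 0 i in LHS]intz scaler_int cE mulrz_suml.
by apply: eq_bigr => k _; rewrite mulrzA (tnth_nth 0).
Qed.

Lemma int_span_neq0 (V : zmodType) (t : nat) (h : t.-tuple V) (v : V) :
  inIntSpan h v -> v != 0 -> exists k : 'I_t, tnth h k != 0.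
Proof.
move=> [a vE] v0; apply/existsP; apply: contraNT v0 => /existsPn h0.
rewrite vE big1 // => k _.
by have /negPn/eqP := h0 k; rewrite (tnth_nth 0) => ->; rewrite mul0rz.
Qed.

Theorem theorem2p8 (R : realType) (d t m : nat)
  (hd : (1 <= d)%N) (ht : (1 <= t)%N) (hm : (1 <= m)%N)
  (h : t.-tuple 'rV[int]_d)
  (hspan : forall v : 'rV[int]_d, inIntSpan h v)
  (f : 'rV[int]_d -> R[i])
  (hf : forall (k : 'I_t) (n : 'rV[int]_d), iter m (fdiff (tnth h k)) f n = 0) :
  (exists (N : nat) (a : 'X_{1..d < N} -> R[i]),
     forall n : 'rV[int]_d,
       f n = \sum_(alpha : 'X_{1..d < N}) a alpha * expmon R[i] n alpha)
  /\
  (* for d = 1, an integer z is identified with the vector const_mx z of Z^1 *)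
  (d = 1%N ->
   exists a : 'I_m -> R[i],
     forall z : int,
       f (const_mx z) = \sum_(j < m) a j * z%:~R ^+ j).
Proof.
have fpoly : exists (N : nat) (a : 'X_{1..d < N} -> R[i]), forall n,
    f n = \sum_(alpha : 'X_{1..d < N}) a alpha * expmon R[i] n alpha.
  have [l [pl lE]] := int_span_coord R[i] hspan.
  apply: polyfun_expmon.
  apply: polyfun_ext (polyfun_lattice (index_enum 'I_t) 0 pl hf) => n.
  by rewrite add0r -lE.
split=> // d1; subst d.
have [N [a fE]] := fpoly.
pose P : {poly R[i]} := \sum_(alpha : 'X_{1..1 < N}) a alpha *: 'X^(alpha ord0).
have fP z : f (const_mx z) = P.[z%:~R].
  rewrite fE horner_sum; apply: eq_bigr => alpha _.
  by rewrite hornerZ hornerXn /expmon big_ord1 mxE.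
have [k hk] : exists k, tnth h k != 0.
  apply: int_span_neq0 (hspan (const_mx 1)) _.
  by apply/eqP => /matrixP/(_ 0 0); rewrite !mxE.
pose s : int := tnth h k 0 0.
have hs : tnth h k = const_mx s by apply/rowP => i; rewrite (ord1 i) mxE.
have s0 : s%:~R != 0 :> R[i].
  by rewrite intr_eq0; apply: contraNneq hk => s0; rewrite hs s0.
pose Q : {poly R[i]} :=
  \sum_(j < m) iter j (fdiff (tnth h k)) f 0 *: newton_poly R[i] j.
have szQ : (size Q <= m)%N.
  apply: (leq_trans (size_sum _ _ _)); apply/bigmax_leqP => j _.
  by rewrite (leq_trans (size_scale_leq _ _)) // size_newton_poly.
have PQ (n : nat) : P.[s%:~R * n%:R] = Q.[n%:R].
  have -> : s%:~R * n%:R = (s *+ n)%:~R :> R[i] by rewrite rmorphMn mulr_natr.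
  have sn : const_mx (s *+ n) = 0 + tnth h k *~ n :> 'rV[int]_1.
    by rewrite add0r hs -pmulrn; apply/rowP => i; rewrite mulmxnE !mxE.
  rewrite -fP sn (newton_expansion (hf k)) horner_sum.
  by apply: eq_bigr => j _; rewrite [RHS]hornerZ mulrC.
have szP : (size P <= m)%N by rewrite (size_poly_eq_on_multiples s0 PQ).
by exists (fun j => P`_j) => z; rewrite fP (horner_coef_wide _ szP).
Qed.
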